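(* Let $G$ be a group and $H$ a subgroup of $G$ such that either the order $|H|$ of $H$ is finite or the index $[G:H]$ is finite. Then the following are equivalent: (1) $H$ is a normal subgroup of $G$. (2) Every $S \in \mathcal{T}(G,H)$ is a both sided transversal of $H$ in $G$. (3) All $S \in \mathcal{T}(G,H)$ are isomorphic, i.e. any two $S, T \in \mathcal{T}(G,H)$ are isomorphic. (4) Every $S \in \mathcal{T}(G,H)$ has the right inverse property (RIP). (5) Every $S \in \mathcal{T}(G,H)$ is right conjugacy closed (RCC).
   Context: Let $G$ be a group and $H$ a subgroup of $G$. A normalized right transversal (NRT) of $H$ in $G$ is a subset $S \subseteq G$ containing exactly one element from each right coset $Hg$ of $H$ in $G$, with $1 \in S$. $\mathcal{T}(G,H)$ denotes the set of all NRTs of $H$ in $G$. Each $S \in \mathcal{T}(G,H)$ carries the induced binary operation $\circ$ defined by $\{x \circ y\} = Hxy \cap S$ for $x,y \in S$. With this operation $S$ is a right loop with two-sided identity $1$, meaning that for all $a,b \in S$ the equation $X \circ a = b$ has a unique solution $X \in S$. Two elements $S,T \in \mathcal{T}(G,H)$ are isomorphic if their induced right loops are isomorphic, i.e. there is a bijection $p: S \to T$ preserving the induced operations. $S$ is a both sided transversal if it is a common set of representatives for the left and the right cosets of $H$ in $G$, i.e. it contains exactly one element of each right coset $Hg$ and exactly one element of each left coset $gH$. For $x \in S$, $R_x : S \to S$ denotes the map $y \mapsto y \circ x$, which is a bijection. Products of such maps are compositions, with the rightmost map applied first. $S$ has the right inverse property (RIP) if there is a map $r: S \to S$ such that $R_x^{-1}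 = R_{r(x)}$ for all $x \in S$. $S$ is right conjugacy closed (RCC) if for each pair $(x,y) \in S \times S$ there exists $z \in S$ such that $R_x R_y R_x^{-1} = R_z$. *)

(* Defs.v *)
From HB Require Import structures.
From mathcomp Require Import all_boot.
From mathcomp Require Import boolp classical_sets functions cardinality.

Set Implicit Arguments.
Unset Strict Implicit.
Unset Printing Implicit Defensive.

Local Open Scope group_scope.
Local Open Scope classical_set_scope.

Section Cosets.
Variables (G : groupType) (H : groupClosed G).

Definition rcoset (g : G) : set G := [set h * g | h in [set` H]].

Definition lcoset (g : G) : set G := [set g * h | h in [set` H]].

Definition normal_subgroup : Prop := forall h g : G, h \in H -> h ^ g \in H.

Definition finite_order : Prop := finite_set [set` H].

Definition finite_index : Prop := finite_set (range rcoset).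

Definition right_transversal (S : set G) : Prop :=
  forall g : G, exists! s : G, (rcoset g `&` S) s.

Definition left_transversal (S : set G) : Prop :=
  forall g : G, exists! s : G, (lcoset g `&` S) s.

Definition both_sided_transversal (S : set G) : Prop :=
  right_transversal S /\ left_transversal S.

Lemma rcosetP (g x : G) : rcoset g x <-> x * g^-1 \in H.
Proof.
split=> [[h hH <-]|xgH]; first by rewrite mulgK.
by exists (x * g^-1); rewrite ?mulgVK.
Qed.

End Cosets.

Record nrt (G : groupType) (H : groupClosed G) := Nrt {
  nrt_set :> set G;
  nrt1 : nrt_set 1;
  nrtP : right_transversal H nrt_set
}.

Section InducedOperation.
Variables (G : groupType) (H : groupClosed G) (S : nrt H).

Lemma nrt_inj (s t : S) : rcoset H (\val t) (\val s) -> s = t.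
Proof.
move=> st; have [u [_ uP]] := nrtP S (\val t).
apply: val_inj; rewrite -(uP _ (conj st (set_mem (valP s)))); apply: uP.
by split; [apply/rcosetP; rewrite mulgV gpred1 | exact: set_mem (valP t)].
Qed.

Lemma rcoset_meet (g : G) :
  exists z : S, [set \val z] = rcoset H g `&` S.
Proof.
have [z [zg zu]] := nrtP S g; exists (SigSub (mem_set zg.2)).
by apply/seteqP; split=> [_ ->|y /zu <-]; [exact: zg |].
Qed.

(* A transversal S coerces to the subtype {x : G | x \in S}; cid extracts the
   unique element of Hxy `&` S, see nrt_opE below. *)
Definition nrt_op (x y : S) : S :=
  projT1 (cid (rcoset_meet (\val x * \val y))).

Lemma nrt_opE (x y : S) :
  [set \val (nrt_op x y)] = rcoset H (\val x * \val y) `&` S.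
Proof. exact: projT2 (cid (rcoset_meet (\val x * \val y))). Qed.

Lemma nrt_op_mem (x y : S) :
  \val (nrt_op x y) * (\val x * \val y)^-1 \in H.
Proof.
have : (rcoset H (\val x * \val y) `&` S) (\val (nrt_op x y)).
  by rewrite -nrt_opE.
by case=> /rcosetP.
Qed.

Definition nrt_R (x : S) : S -> S := fun y => nrt_op y x.

Lemma nrt_R_bij (x : S) : bijective (nrt_R x).
Proof.
rewrite -setTT_bijective; split=> // [y z _ _ eyz|b _].
  apply: nrt_inj; apply/rcosetP.
  have := nrt_op_mem z x; rewrite -[nrt_op z x]/(nrt_R x z) -eyz.
  move=> /(gpredM _ _ (gpredVr _ (nrt_op_mem y x))).
  by rewrite /nrt_R !invgM !invgK -!mulgA mulKg mulVKg.
have [a ab] := rcoset_meet (\val b * (\val x)^-1); exists a => //.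
have [/rcosetP aH _] : (rcoset H (\val b * (\val x)^-1) `&` S) (\val a).
  by rewrite -ab.
apply: nrt_inj; apply/rcosetP.
have := gpredM _ _ (nrt_op_mem a x) aH.
by rewrite !invgM !invgK -!mulgA mulKg mulKg.
Qed.

(* This gives (nrt_R x)^-1%FUN its meaning as the two-sided inverse map. *)
HB.instance Definition _ (x : S) :=
  BijTT.Build S S (nrt_R x) (nrt_R_bij x).

Definition right_inverse_property : Prop :=
  exists r : S -> S, forall x : S, (nrt_R x)^-1%FUN = nrt_R (r x).

Definition right_conjugacy_closed : Prop :=
  forall x y : S, exists z : S,
    nrt_R x \o nrt_R y \o (nrt_R x)^-1%FUN = nrt_R z.

End InducedOperation.

Definition nrt_isomorphic (G : groupType) (H : groupClosed G) (S T : nrt H) :=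
  exists p : S -> T,
    bijective p /\ {morph p : x y / nrt_op x y >-> nrt_op x y}.

(* Main.v *)
Require Import Defs.
From mathcomp Require Import all_boot.
From mathcomp Require Import boolp classical_sets functions cardinality.

(** The induced operation is multiplication followed by the projection of G
    onto S along the right cosets, so R_x is the permutation of the set of
    right cosets Hg given by right multiplication by x. If H is normal, this
    set is the group G/H, every S is a copy of it, and all the other conditions
    follow. For the converses the main tool is that transversals can be
    prescribed freely: any nontrivial representative can be replaced by any
    other element of its right coset ([nrt_replace]).

    Suppose that H is not normal. Then some left coset gH meets two different
    right cosets, and some S contains two elements of gH. Such an S is not a
    left transversal. Moreover, if x in S represents H g^-1, then these two
    elements are both solutions y of x o y = 1; but in a right loop with the
    right inverse property every x has only one right inverse
    ([normal_of_lcoset_inj], [both_sided_normal], [rip_normal]).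

    Right conjugacy closedness says that for x, y in S the conjugate y^x acts
    on the right cosets like some z in S. If z represented a coset other than
    H, Hx and Hy, one could replace z by hz, where h in H acts nontrivially,
    and y^x could not act like hz as well. As z in H or z in Hx are ruled out
    directly, y^x acts like y, for all x, y outside H in different right cosets
    ([rcc_commute]). Comparing this for y and for hy shows that h^x acts like h,
    and therefore lies in H ([rcc_normal]).

    Finiteness enters when all transversals are isomorphic. The right inverses
    of x in S are the elements of S in the left coset x^-1 H, so the largest number n of
    elements that S has in a common left coset is an isomorphism invariant. It is
    bounded by the order or the index of H, whichever is finite.
    Suppose that all S are isomorphic, so that n is the same for all of them.
    If n = 1 then H is normal, as above. If n > 1, choose T such that no left
    coset containing two elements of T contains all the elements of T of its
    double coset ([nrt_spread]). Then a left coset with n elements of T leaves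
    out some t in T of the same double coset; the right coset Ht meets this
    left coset, and moving t there gives a transversal with n + 1 elements in
    one left coset, a contradiction. Such a T exists unless some double coset
    HgH is a single left coset while containing several right cosets, that is,
    unless H^g is a proper subgroup of H; finiteness excludes this
    ([conj_stableV]). *)

Set Implicit Arguments.
Unset Strict Implicit.
Unset Printing Implicit Defensive.

Local Open Scope group_scope.
Local Open Scope classical_set_scope.

(** * Right cosets *)

Section SameCoset.
Variables (G : groupType) (H : groupClosed G).
Implicit Types x y z g h k u : G.

Definition same_coset x y : bool := x * y^-1 \in H.
Local Notation "x ~ y" := (same_coset x y) (at level 70).

Lemma same_coset_refl x : x ~ x.
Proof. by rewrite /same_coset mulgV gpred1. Qed.

Lemma same_coset_sym x y : (x ~ y) = (y ~ x).
Proof. by rewrite /same_coset gpredFC. Qed.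

Lemma same_coset_trans y x z : x ~ y -> y ~ z -> x ~ z.
Proof. by move=> xy /(gpredM _ _ xy); rewrite mulgA mulgVK. Qed.

Lemma same_cosetMr z x y : (x * z ~ y * z) = (x ~ y).
Proof. by rewrite /same_coset invgM mulgA mulgK. Qed.

Lemma same_cosetMl h x : h \in H -> h * x ~ x.
Proof. by rewrite /same_coset mulgK. Qed.

Lemma same_coset1 x : (x ~ 1) = (x \in H).
Proof. by rewrite /same_coset invg1 mulg1. Qed.

Lemma same_coset_mem x y : x ~ y -> (x \in H) = (y \in H).
Proof.
by move=> xy; apply/idP/idP; rewrite -!same_coset1; apply: same_coset_trans;
   rewrite // same_coset_sym.
Qed.

Lemma same_coset_eqr x y z : x ~ y -> (z ~ x) = (z ~ y).
Proof.
by move=> xy; apply/idP/idP => zx; apply: (same_coset_trans zx); rewrite // same_coset_sym.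
Qed.

Lemma same_coset_eql x y z : x ~ y -> (x ~ z) = (y ~ z).
Proof. by move=> xy; rewrite !(same_coset_sym _ z) (same_coset_eqr _ xy). Qed.

Lemma normal_same_cosetM x x' y y' : normal_subgroup H ->
  x ~ x' -> y ~ y' -> x * y ~ x' * y'.
Proof.
move=> nH xx yy; apply: (@same_coset_trans (x * y')); last by rewrite same_cosetMr.
have := nH _ x^-1 yy.
by rewrite /same_coset conjgE invgK invgM !mulgA.
Qed.

(** * Constructing transversals *)

Lemma nrt_rep (S : nrt H) g : exists2 s, nrt_set S s & s ~ g.
Proof. by have [s [[/rcosetP sg Ss] _]] := nrtP S g; exists s. Qed.

Lemma nrt_uniq (S : nrt H) s t : nrt_set S s -> nrt_set S t -> s ~ t -> s = t.
Proof.
move=> Ss St st; have [u [_ uP]] := nrtP S t.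
rewrite -(uP s) ?(uP t) //; split=> //; apply/rcosetP => //.
exact: same_coset_refl.
Qed.

(** Transversals correspond to the choice functions f on right cosets: the
    transversal is the set of values of f, which is its set of fixed points. *)
Lemma nrt_of_fun (f : G -> G) :
  f 1 = 1 -> (forall x, f x ~ x) -> (forall x y, x ~ y -> f x = f y) ->
  exists S : nrt H, forall x, nrt_set S x <-> f x = x.
Proof.
move=> f1 fx ff.
have rt : right_transversal H [set x | f x = x].
  move=> g; exists (f g); split=> [|s [/rcosetP sg <-]]; last exact/esym/ff.
  by split; [apply/rcosetP; exact: fx | apply: ff; exact: fx].
by exists (@Nrt _ H [set x | f x = x] f1 rt).
Qed.

Lemma nrt_inhabited : inhabited (nrt H).
Proof.
pose f x := if x \in H then 1 else xget 1 [set y | y ~ x].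
have [|x|x y xy|S _] := @nrt_of_fun f; last exact: inhabits.
- by rewrite /f gpred1.
- rewrite /f; case: ifPn => [xH|_]; first by rewrite same_coset_sym same_coset1.
  exact: (xgetPex 1 (ex_intro (fun y => y ~ x) x (same_coset_refl x))).
- rewrite /f (same_coset_mem xy); congr (if _ then _ else xget _ _).
  by apply/seteqP; split=> z /=; rewrite (same_coset_eqr _ xy).
Qed.

(** The representative of Hc becomes c; the hypothesis on c keeps 1 as the
    representative of H. *)
Lemma nrt_replace (S : nrt H) c : c \notin H ->
  exists2 S' : nrt H, nrt_set S' c & forall x, nrt_set S x -> ~~ (x ~ c) -> nrt_set S' x.
Proof.
move=> cH.
pose f x := if x ~ c then c else xget 1 [set y | nrt_set S y /\ y ~ x].
have ex x : exists y, [set y | nrt_set S y /\ y ~ x] y.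
  by have [y Sy yx] := nrt_rep S x; exists y.
have [|x|x y xy|S' S'P] := @nrt_of_fun f.
- rewrite /f same_coset_sym same_coset1 (negPf cH).
  have [/= S1 s1] := xgetPex 1 (ex 1).
  exact: nrt_uniq S1 (nrt1 S) s1.
- rewrite /f; case: ifPn => [xc|_]; first by rewrite same_coset_sym.
  by have [] := xgetPex 1 (ex x).
- rewrite /f (same_coset_eql _ xy); congr (if _ then _ else xget _ _).
  by apply/seteqP; split=> z /=; rewrite (same_coset_eqr _ xy).
exists S' => [|x Sx xc]; apply/S'P; rewrite /f ?same_coset_refl // (negPf xc).
have [/= S1 s1] := xgetPex 1 (ex x).
exact: nrt_uniq S1 Sx s1.
Qed.

Lemma nrt_two x y : x \notin H -> y \notin H -> ~~ (x ~ y) ->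
  exists S : nrt H, nrt_set S x /\ nrt_set S y.
Proof.
move=> xH yH xy; have [S] := nrt_inhabited.
have [S1 S1x _] := nrt_replace S xH.
have [S2 S2y S2P] := nrt_replace S1 yH.
by exists S2; split=> //; exact: S2P.
Qed.

(** If h is in H but h^g is not, then g^-1 and g^-1 h lie in the same left
    coset of H and in different right cosets, so that some transversal contains
    both. *)
Lemma normal_of_lcoset_inj :
  (forall (S : nrt H) u s t, nrt_set S s -> nrt_set S t -> u * s \in H -> u * t \in H -> s = t) ->
  normal_subgroup H.
Proof.
move=> inj h g hH; apply/negPn/negP => nhg.
have gH : g^-1 \notin H.
  by apply: contra nhg; rewrite gpredV => gH; apply: gpredJ.
have ghH : g^-1 * h \notin H by rewrite gpredMr.
have [|S [Sg Sgh]] := nrt_two gH ghH.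
  by apply: contra nhg; rewrite same_coset_sym /same_coset invgK conjgE mulgA.
have e := inj S g _ _ Sg Sgh; move: nhg.
have := e; rewrite mulgV mulVKg gpred1 => /(_ isT hH) /eqP.
by rewrite -{1}[g^-1]mulg1 => /eqP/mulgI <-; rewrite conj1g gpred1.
Qed.

(** * The induced right loop *)

Definition nrt_elt (S : nrt H) x (Sx : nrt_set S x) : S := SigSub (mem_set Sx).

Lemma nrt_elt_val (S : nrt H) (x : S) : nrt_set S (\val x).
Proof. exact: set_mem (valP x). Qed.

Lemma nrt_op_eq (S : nrt H) (x y z : S) :
  (nrt_op x y = z) <-> (\val z ~ \val x * \val y).
Proof.
split=> [<-|zxy]; first exact: nrt_op_mem.
apply: nrt_inj; apply/rcosetP; apply: same_coset_trans (nrt_op_mem x y) _.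
by rewrite same_coset_sym.
Qed.

Lemma nrt_RP (S : nrt H) (x y : S) : \val (nrt_R x y) ~ \val y * \val x.
Proof. exact: nrt_op_mem. Qed.

Lemma nrt_R_invE (S : nrt H) (x u : S) : (nrt_R x)^-1%FUN (nrt_R x u) = u.
Proof. by rewrite (funK (s := nrt_R x)) ?in_setT. Qed.

(** * Both sided transversals and the right inverse property *)

Lemma normal_both_sided (S : nrt H) :
  normal_subgroup H -> both_sided_transversal H S.
Proof.
move=> nH; split; first exact: nrtP.
have lP g x : lcoset H g x <-> x ~ g.
  split=> [[h hH <-]|xg].
    rewrite /same_coset -mulgA -{1}[g]invgK; exact: nH.
  exists (g^-1 * x); last by rewrite mulVKg.
  by have := nH _ g xg; rewrite conjgE mulgVK.
move=> g; have [s Ss sg] := nrt_rep S g; exists s; split; first by split=> //; apply/lP.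
move=> t [/lP tg St]; apply: (nrt_uniq Ss St); apply: same_coset_trans sg _.
by rewrite same_coset_sym.
Qed.

Lemma both_sided_normal :
  (forall S : nrt H, both_sided_transversal H S) -> normal_subgroup H.
Proof.
move=> bs; apply: normal_of_lcoset_inj => S u s t Ss St us ut.
have [w [_ wP]] := (bs S).2 u^-1.
rewrite -(wP s) ?(wP t) //; split=> //.
  by exists (u * t) => //; rewrite mulKg.
by exists (u * s) => //; rewrite mulKg.
Qed.

Lemma normal_isomorphic (S T : nrt H) :
  normal_subgroup H -> nrt_isomorphic S T.
Proof.
move=> nH.
have ex (A B : nrt H) (x : A) : exists y : B, \val y ~ \val x.
  by have [y By yx] := nrt_rep B (\val x); exists (nrt_elt By).
have [p pP] := choice (ex S T); have [q qP] := choice (ex T S).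
exists p; split.
  exists q => x; apply: nrt_inj; apply/rcosetP.
    exact: same_coset_trans (qP _) (pP _).
  exact: same_coset_trans (pP _) (qP _).
move=> x y; apply/esym/nrt_op_eq; apply: same_coset_trans (pP _) _.
apply: same_coset_trans (nrt_op_mem x y) _.
by apply: normal_same_cosetM => //; rewrite same_coset_sym.
Qed.

Lemma normal_rip (S : nrt H) : normal_subgroup H -> right_inverse_property S.
Proof.
move=> nH.
have ex (x : S) : exists y : S, \val y ~ (\val x)^-1.
  by have [y By yx] := nrt_rep S (\val x)^-1; exists (nrt_elt By).
have [r rP] := choice ex; exists r => x; apply/funext => v.
have [w _ wK] := nrt_R_bij x.
rewrite -[v]wK nrt_R_invE; apply/esym/nrt_op_eq; rewrite same_coset_sym.
rewrite -[X in _ ~ X](mulgK (\val x)); apply: normal_same_cosetM => //.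
exact: nrt_RP.
Qed.

(** If R_x^-1 = R_(r x) for all x, then x o y = 1 gives
    x = R_y^-1 (1) = R_(r y) (1) = r y. Two right inverses s and t of x thus have
    r s = r t, so R_s and R_t have the same inverse, and s = R_s (1) = t. *)
Lemma rip_normal :
  (forall S : nrt H, right_inverse_property S) -> normal_subgroup H.
Proof.
move=> rip; apply: normal_of_lcoset_inj => S u s t Ss St us ut.
have [x Sx xu] := nrt_rep S u; have [r rP] := rip S.
pose e : S := nrt_elt (nrt1 S).
have rE y (Sy : nrt_set S y) : u * y \in H -> r (nrt_elt Sy) = nrt_elt Sx.
  move=> uy; have Rx : nrt_R (nrt_elt Sy) (nrt_elt Sx) = e.
    apply/nrt_op_eq; rewrite same_coset_sym same_coset1.
    by rewrite (@same_coset_mem _ (u * y)) // same_cosetMr.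
  rewrite -[RHS](nrt_R_invE (nrt_elt Sy)) Rx rP.
  by apply/esym/nrt_op_eq; rewrite mul1g same_coset_refl.
have Re (y : S) : nrt_R y e = y by apply/nrt_op_eq; rewrite mul1g same_coset_refl.
have : nrt_R (nrt_elt Ss) e = nrt_R (nrt_elt St) e.
  rewrite -[e in LHS](nrt_R_invE (nrt_elt St)) rP rE // -(rE _ Ss) // -rP.
  have [w _ wK] := nrt_R_bij (nrt_elt Ss).
  by rewrite -[X in (nrt_R _)^-1%FUN X]wK nrt_R_invE wK.
by rewrite !Re => /(congr1 \val).
Qed.

(** * Right conjugacy closed transversals *)

Lemma normal_rcc (S : nrt H) : normal_subgroup H -> right_conjugacy_closed S.
Proof.
move=> nH x y.
have [z Sz zP] := nrt_rep S (\val y ^ \val x); exists (nrt_elt Sz).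
apply/funext => v /=; have [w _ wK] := nrt_R_bij x.
rewrite -[v]wK nrt_R_invE; move: (w v) => u.
apply/esym/nrt_op_eq; apply: same_coset_trans (nrt_RP _ _) _.
rewrite (@same_coset_eql _ (\val u * \val y * \val x)); last first.
  by rewrite same_cosetMr; exact: nrt_RP.
rewrite -mulgA (conjgC (\val y)) mulgA; apply: normal_same_cosetM => //.
  by rewrite same_coset_sym; exact: nrt_RP.
by rewrite same_coset_sym.
Qed.

(** Equality of the permutations of the right cosets given by right
    multiplication, i.e. congruence modulo the core of H. *)
Definition same_action x y : Prop := forall g, g * x ~ g * y.

Lemma same_action_sym x y : same_action x y -> same_action y x.
Proof. by move=> xy g; rewrite same_coset_sym. Qed.

Lemma same_action_trans y x z : same_action x y -> same_action y z -> same_action x z.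
Proof. by move=> xy yz g; apply: same_coset_trans (xy g) (yz g). Qed.

Lemma same_actionMr z x y : same_action x y -> same_action (x * z) (y * z).
Proof. by move=> xy g; rewrite !mulgA same_cosetMr. Qed.

Lemma same_actionMl z x y : same_action x y -> same_action (z * x) (z * y).
Proof. by move=> xy g; rewrite !mulgA. Qed.

Lemma same_action_coset x y : same_action x y -> x ~ y.
Proof. by move=> /(_ 1); rewrite !mul1g. Qed.

(** The order of composition of the maps R_x is opposite to the product in G,
    whence the conjugate x^-1 y x. Applying the equation to x-translates of S
    reaches all right cosets. *)
Lemma conj_same_action (S : nrt H) (x y z : S) :
  nrt_R x \o nrt_R y \o (nrt_R x)^-1%FUN = nrt_R z ->
  same_action (\val y ^ \val x) (\val z).
Proof.
move=> zP g; have [u Su ug] := nrt_rep S (g * (\val x)^-1).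
pose v : S := nrt_elt Su.
have e : nrt_R x (nrt_R y v) = nrt_R z (nrt_R x v).
  by rewrite -zP /comp nrt_R_invE.
have xyv : \val (nrt_R x (nrt_R y v)) ~ u * \val y * \val x.
  by apply: same_coset_trans (nrt_RP _ _) _; rewrite same_cosetMr; exact: nrt_RP.
have zxv : \val (nrt_R z (nrt_R x v)) ~ u * \val x * \val z.
  by apply: same_coset_trans (nrt_RP _ _) _; rewrite same_cosetMr; exact: nrt_RP.
rewrite (@same_coset_eqr _ (u * \val x * \val z)); last first.
  by rewrite same_cosetMr -(same_cosetMr (\val x)^-1) mulgK same_coset_sym.
rewrite -(same_coset_eqr _ zxv) -e (same_coset_eqr _ xyv) conjgE !mulgA.
by rewrite !same_cosetMr same_coset_sym.
Qed.

Lemma rcc_conj (S : nrt H) x y :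
  right_conjugacy_closed S -> nrt_set S x -> nrt_set S y ->
  exists2 z, nrt_set S z & same_action (y ^ x) z.
Proof.
move=> rcc Sx Sy; have [z zP] := rcc (nrt_elt Sx) (nrt_elt Sy).
exists (\val z); [exact: nrt_elt_val | exact: (conj_same_action zP)].
Qed.

(** The element z of S acting like y^x is y itself: any other position of z
    either contradicts the choice of x and y, or leaves room for replacing z by
    an element h0 z that acts differently. *)
Lemma rcc_commute x y : (forall S : nrt H, right_conjugacy_closed S) ->
  ~ normal_subgroup H -> x \notin H -> y \notin H -> ~~ (x ~ y) ->
  same_action (y ^ x) y.
Proof.
move=> rcc nnH xH yH xy.
(* H is not normal, so it is not contained in its core. *)
have [h0 hH0 nh0] : exists2 h0, h0 \in H & ~ same_action h0 1.
  apply: contrapT => no; apply: nnH => h g hH.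
  apply: contrapT => nhg; apply: no; exists h => // /(_ g^-1).
  by rewrite mulg1 /same_coset invgK -mulgA -conjgE.
have [S [Sx Sy]] := nrt_two xH yH xy.
have [z Sz yxz] := rcc_conj (rcc S) Sx Sy.
have [zH|zH] := boolP (z \in H).
  have z1 : z = 1 by apply: (nrt_uniq Sz (nrt1 S)); rewrite same_coset1.
  move: yxz; rewrite z1 => /(same_actionMl x)/(same_actionMr x^-1).
  rewrite mulg1 mulgV conjgE mulVKg mulgK => /same_action_coset.
  by rewrite same_coset1 (negPf yH).
have [zx|zx] := boolP (z ~ x).
  move: yxz; rewrite (nrt_uniq Sz Sx zx) => /(same_actionMl x)/(same_actionMr x^-1).
  rewrite conjgE mulVKg !mulgK => /same_action_coset.
  by rewrite same_coset_sym (negPf xy).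
have [zy|zy] := boolP (z ~ y); first by rewrite -{2}(nrt_uniq Sz Sy zy).
have hz : h0 * z ~ z by exact: same_cosetMl.
have [|S' S'z S'P] := nrt_replace S (c := h0 * z); first by rewrite (same_coset_mem hz).
have sep w : ~~ (z ~ w) -> ~~ (w ~ h0 * z) by rewrite (same_coset_eqr _ hz) same_coset_sym.
have [z' S'z' yxz'] := rcc_conj (rcc S') (S'P _ Sx (sep _ zx)) (S'P _ Sy (sep _ zy)).
have zz' := same_action_trans (same_action_sym yxz') yxz.
have z'E : z' = h0 * z.
  apply: nrt_uniq S'z' S'z _; rewrite (same_coset_eqr _ hz).
  exact: same_action_coset.
case: nh0; move: zz'; rewrite z'E => /(same_actionMr z^-1).
by rewrite mulgK mulgV.
Qed.

(** With y in neither H nor Hg, both y and h y are acted on trivially by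
    conjugation by g modulo the core, hence so is h. Without such a y the index
    of H is at most 2. *)
Lemma rcc_normal :
  (forall S : nrt H, right_conjugacy_closed S) -> normal_subgroup H.
Proof.
move=> rcc; apply: contrapT => nnH; apply: (nnH) => h g hH.
have [gH|gH] := boolP (g \in H); first exact: gpredJ.
have [[y yH gy]|no] := pselect (exists2 y, y \notin H & ~~ (g ~ y)).
  have hy : h * y ~ y by exact: same_cosetMl.
  have c1 := rcc_commute rcc nnH gH yH gy.
  have c2 : same_action ((h * y) ^ g) (h * y).
    by apply: rcc_commute; rewrite ?(same_coset_mem hy) ?(same_coset_eqr _ hy).
  have /same_action_coset : same_action (h ^ g * y) (h * y).
    apply: same_action_trans c2; rewrite conjMg.
    exact/same_actionMl/same_action_sym.
  by rewrite same_cosetMr => /same_coset_mem ->.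
(* If h^g is not in H, it is not in Hg either, so it can serve as y. *)
apply: contrapT => /negP nhg; apply: no; exists (h ^ g) => //.
by rewrite same_coset_sym /same_coset conjgE mulgA mulgK gpredMr // gpredV.
Qed.


(** * Double cosets and spread transversals *)

Definition same_dcoset x y : Prop := exists2 k, k \in H & y ~ x * k.

Lemma same_dcoset_refl x : same_dcoset x x.
Proof. by exists 1; rewrite ?gpred1 // mulg1 same_coset_refl. Qed.

Lemma same_dcoset_sym x y : same_dcoset x y -> same_dcoset y x.
Proof.
move=> [k kH yxk]; exists k^-1; rewrite ?gpredV //.
by rewrite -(same_cosetMr k) mulgVK same_coset_sym.
Qed.

Lemma same_dcoset_trans y x z :
  same_dcoset x y -> same_dcoset y z -> same_dcoset x z.
Proof.
move=> [k kH yxk] [l lH zyl]; exists (k * l); first exact: gpredM.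
by apply: same_coset_trans zyl _; rewrite mulgA same_cosetMr.
Qed.

Lemma same_coset_dcoset x y : x ~ y -> same_dcoset x y.
Proof. by move=> xy; exists 1; rewrite ?gpred1 // mulg1 same_coset_sym. Qed.

Lemma same_dcoset_eq x y : same_dcoset x y -> same_dcoset x = same_dcoset y.
Proof.
move=> xy; apply/seteqP; split=> z; apply: same_dcoset_trans => //.
exact: same_dcoset_sym.
Qed.

(** In each double coset D choose g, and if possible h in D outside gH. The right
    coset Hg is represented by g, and the other right cosets in D by elements of
    hH, which they meet. If D = gH, then H^g is contained in H, so by hypothesis
    H^g = H and D is a single right coset. *)
Lemma nrt_spread :
  (forall g, (forall h, h \in H -> h ^ g \in H) ->
     forall h, h \in H -> h ^ g^-1 \in H) ->
  exists T : nrt H, forall u y1 y2, nrt_set T y1 -> nrt_set T y2 ->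
    u * y1 \in H -> u * y2 \in H -> y1 <> y2 ->
    exists2 t, nrt_set T t & same_dcoset u^-1 t /\ u * t \notin H.
Proof.
move=> conjV.
(* 1 is chosen in the double coset H to make the transversal normalized; when
   D = gH the default value g for h keeps h in D. *)
pose g (D : set G) := if `[< D 1 >] then 1 else xget 1 D.
pose h (D : set G) := xget (g D) [set y | D y /\ (g D)^-1 * y \notin H].
pose f x := let D := same_dcoset x in
  if x ~ g D then g D else xget 1 [set y | y ~ x /\ (h D)^-1 * y \in H].
have gP x : same_dcoset x (g (same_dcoset x)).
  rewrite /g; case: asboolP => // _.
  exact: (xgetPex 1 (ex_intro _ x (same_dcoset_refl x))).
have hP x : same_dcoset x (h (same_dcoset x)).
  rewrite /h; case: xgetP => [y _ [] //|_]; exact: gP.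
have fex x : exists y, [set y | y ~ x /\ (h (same_dcoset x))^-1 * y \in H] y.
  have [k kH xhk] := same_dcoset_sym (hP x).
  by exists (h (same_dcoset x) * k); rewrite /= same_coset_sym mulKg.
have [|x|x y xy|T TP] := @nrt_of_fun f.
- have g1 : g (same_dcoset 1) = 1.
    by rewrite /g; case: asboolP => // -[]; exact: same_dcoset_refl.
  by rewrite /f g1 same_coset_refl.
- rewrite /f; case: ifPn => [xg|_]; first by rewrite same_coset_sym.
  by have [] := xgetPex 1 (fex x).
- rewrite /f (same_dcoset_eq (same_coset_dcoset xy)) (same_coset_eql _ xy).
  congr (if _ then _ else xget _ _).
  by apply/seteqP; split=> z /=; rewrite (same_coset_eqr _ xy).
exists T => u y1 y2 Ty1 Ty2 uy1 uy2 y12.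
pose D := same_dcoset u^-1.
have Dy y : u * y \in H -> same_dcoset y = D.
  move=> uy; apply/esym/same_dcoset_eq; exists (u * y) => //.
  by rewrite mulKg same_coset_refl.
have Dg : same_dcoset (g D) = D by apply/esym/same_dcoset_eq; exact: gP.
exists (g D); first by apply/TP; rewrite /f Dg same_coset_refl.
split; first exact: gP.
apply/negP => ug.
(* If g were in the left coset of u^-1, all the elements of T in this left coset
   would be equal to g. *)
have yg y : nrt_set T y -> u * y \in H -> y = g D.
  move=> /TP fy uy; suff yg : y ~ g D by rewrite -fy /f (Dy _ uy) yg.
  apply/negPn/negP => nyg.
  have hy : (h D)^-1 * y \in H.
    rewrite -fy /f (Dy _ uy) (negPf nyg).
    by have := fex y; rewrite (Dy _ uy) => /(xgetPex 1) [].
  have uh : u * h D \in H.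
    by rewrite -(gpredMr _ hy) -mulgA mulVKg.
  have gh : (g D)^-1 * h D \in H.
    by rewrite -(gpredMl _ ug) -mulgA mulVKg.
  have Dsub z : D z -> (g D)^-1 * z \in H.
    move=> Dz; apply/negPn/negP => gz.
    have [_] := xgetPex (g D) (ex_intro (fun y => D y /\ (g D)^-1 * y \notin H) z (conj Dz gz)).
    by rewrite -/(h D) gh.
  have Hg : forall k, k \in H -> k ^ (g D) \in H.
    move=> k kH; rewrite conjgE; apply: Dsub.
    apply: same_dcoset_trans (gP _) _; apply: same_coset_dcoset.
    by rewrite same_coset_sym same_cosetMl.
  have := conjV _ Hg _ (Dsub y _); rewrite conjgE invgK mulgA mulVKg => yg.
  move/negP: nyg; apply; apply: yg.
  by rewrite -(Dy _ uy); exact: same_dcoset_refl.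
by apply: y12; rewrite (yg y1) // (yg y2).
Qed.

(** * Isomorphic transversals *)

(** When u is in S, the list s consists of n right inverses of u in the right
    loop S; a general u gives the same condition with a more flexible left coset. *)
Definition crowded (S : nrt H) n : Prop :=
  exists u (s : seq G), [/\ uniq s, size s = n &
    forall y, y \in s -> nrt_set S y /\ u * y \in H].

(** Only the representative x of Hu in S matters, and an isomorphism maps the
    right inverses of x to right inverses of its image. *)
Lemma isomorphic_crowded (S T : nrt H) n :
  nrt_isomorphic S T -> crowded S n -> crowded T n.
Proof.
move=> [p [pbij pM]] [u [s [us ss sP]]].
have pinj := bij_inj pbij.
pose eS : S := nrt_elt (nrt1 S); pose eT : T := nrt_elt (nrt1 T).
have p1 : p eS = eT.
  apply: (bij_inj (nrt_R_bij (p eS))).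
  transitivity (p eS); last by apply/esym/nrt_op_eq; rewrite mul1g same_coset_refl.
  rewrite /nrt_R -pM; congr p; apply/nrt_op_eq.
  by rewrite mul1g same_coset_refl.
have [x Sx xu] := nrt_rep S u.
pose q y := p (insubd eS y).
have qK y : y \in s -> \val (insubd eS y) = y.
  by move=> /sP[Sy _]; rewrite insubdK //; exact: mem_set.
exists (\val (p (nrt_elt Sx))), [seq \val (q y) | y <- s].
split; last 1 first.
- move=> _ /mapP[y ys ->]; split; first exact: nrt_elt_val.
  rewrite -same_coset1 same_coset_sym.
  apply: (iffLR (nrt_op_eq _ _ eT)).
  rewrite /q -pM -p1; congr p; apply/nrt_op_eq.
  rewrite qK // same_coset_sym same_coset1.
  by have [_] := sP y ys; apply: etrans; apply: same_coset_mem; rewrite same_cosetMr.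
- rewrite map_inj_in_uniq // => y z ys zs /val_inj/pinj/(congr1 \val).
  by rewrite !qK.
- by rewrite size_map.
Qed.

(** The elements of S in u^-1 H inject into H by y |-> u y, and into the set of
    right cosets by y |-> Hy. *)
Lemma crowded_bounded : finite_order H \/ finite_index H ->
  exists N, forall (S : nrt H) n, crowded S n -> n <= N.
Proof.
move=> [] /finite_seqP[l lP]; exists (size l) => S _ [u [s [us <- sP]]].
  rewrite -(size_map (mul u)); apply: uniq_leq_size.
    by rewrite map_inj_uniq //; exact: mulgI.
  move=> _ /mapP[y /sP[_ uy] ->].
  by have : [set` H] (u * y) by []; rewrite lP.
rewrite -(size_map (rcoset H)); apply: uniq_leq_size.
  rewrite map_inj_in_uniq // => y z /sP[Sy _] /sP[Sz _] yz.
  apply: nrt_uniq Sy Sz _; apply/rcosetP; rewrite -yz; apply/rcosetP.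
  exact: same_coset_refl.
move=> _ /mapP[y _ ->].
by have : range (rcoset H) (rcoset H y) by []; rewrite lP.
Qed.

(** If H is finite, conjugation by g is an injection of H into itself, hence
    onto. If the index is finite, two powers of g lie in the same right coset, so
    some g^n with n > 0 is in H, and conjugation by g^-1 is conjugation by g^-n
    followed by conjugation by g^(n-1). *)
Lemma conj_stableV g : finite_order H \/ finite_index H ->
  (forall h, h \in H -> h ^ g \in H) -> forall h, h \in H -> h ^ g^-1 \in H.
Proof.
move=> [] /finite_seqP[l lP] Hg h hH.
  have lE x : (x \in undup l) = (x \in H).
    rewrite mem_undup; apply/idP/idP => xl.
      by have : [set` l] x by []; rewrite -lP.
    by have : [set` H] x by []; rewrite lP.
  have [|||_ mE] := @uniq_min_size _ [seq x ^ g | x <- undup l] (undup l).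
  - by rewrite map_inj_uniq ?undup_uniq //; exact: conjg_inj.
  - by move=> _ /mapP[x xl ->]; move: xl; rewrite !lE; exact: Hg.
  - by rewrite size_map.
  have := mE h; rewrite lE hH => /mapP[x].
  by rewrite lE => xH ->; rewrite conjgK.
pose c i := rcoset H (g ^+ i).
have /(uniqPn (c 0)) [i [j [ij jl]]] : ~~ uniq [seq c i | i <- iota 0 (size l).+1].
  apply/negP => /uniq_leq_size => /(_ l) sl.
  suff : (size l).+1 <= size l by rewrite ltnn.
  rewrite -[X in X <= _](size_iota 0) -(size_map c); apply: sl.
  move=> _ /mapP[k _ ->].
  by have : range (rcoset H) (c k) by []; rewrite lP.
rewrite size_map size_iota in jl.
rewrite !(nth_map 0) ?size_iota //; last exact: ltn_trans jl.
rewrite !nth_iota //; last exact: ltn_trans jl.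
rewrite !add0n => cij.
have gij : g ^+ j * (g ^+ i)^-1 \in H.
  apply/rcosetP; rewrite -/(c i) cij; apply/rcosetP; exact: same_coset_refl.
rewrite -expgnFr // in gij; last exact: ltnW.
have -> : h ^ g^-1 = (h ^ (g ^+ (j - i))^-1) ^ (g ^+ (j - i).-1).
  rewrite -conjgM; congr (_ ^ _).
  have -> : j - i = (j - i).-1.+1 by rewrite prednK // subn_gt0.
  by rewrite /= expgSr invgM mulgVK.
have Hgn n k : k \in H -> k ^ (g ^+ n) \in H.
  move=> kH; elim: n => [|n IHn]; first by rewrite expg0 conjg1.
  by rewrite expgSr conjgM; exact: Hg.
by apply: Hgn; apply: gpredJ => //; rewrite gpredV.
Qed.

Lemma isomorphic_normal : finite_order H \/ finite_index H ->
  (forall S T : nrt H, nrt_isomorphic S T) -> normal_subgroup H.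
Proof.
move=> finH iso.
have [T Tspread] := nrt_spread (fun g => conj_stableV finH).
have [N NP] := crowded_bounded finH.
have ex1 : exists n, `[< crowded T n >].
  by exists 0; apply/asboolP; exists 1, [::]; split=> //.
have ub n : `[< crowded T n >] -> n <= N by move=> /asboolP; exact: NP.
have [n /asboolP Tn nmax] := ex_maxnP ex1 ub.
have maxS (S : nrt H) m : crowded S m -> m <= n.
  by move=> Sm; apply: nmax; apply/asboolP; exact: isomorphic_crowded Sm.
apply: normal_of_lcoset_inj => S u s1 s2 Ss1 Ss2 us1 us2; apply: contrapT => s12.
(* Two elements in one left coset force the common maximum n to exceed 1. *)
have n2 : 1 < n.
  apply: (maxS S); exists u, [:: s1; s2]; split=> //.
    by rewrite /= inE andbT; apply/eqP.
  by move=> y; rewrite !inE => /orP[] /eqP ->.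
case: Tn => v [l [ul sl lP]].
have [y1 [y2 [y1l y2l y12]]] : exists y1 y2, [/\ y1 \in l, y2 \in l & y1 <> y2].
  case: l ul sl {lP} => [|y1 [|y2 l]] /=; [by move=> _ n0; rewrite -n0 in n2 .. |].
  rewrite inE => /andP[/norP[/eqP y12 _] _] _.
  by exists y1, y2; rewrite !inE !eqxx orbT.
have [[Ty1 vy1] [Ty2 vy2]] := (lP _ y1l, lP _ y2l).
have [t Tt [[k kH tc] vt]] := Tspread v y1 y2 Ty1 Ty2 vy1 vy2 y12.
have cH : v^-1 * k \notin H.
  rewrite gpredMr // gpredV; apply/negP => vH; apply: y12.
  rewrite !gpredMl // -!same_coset1 in vy1 vy2.
  by rewrite (nrt_uniq Ty1 (nrt1 T) vy1) (nrt_uniq Ty2 (nrt1 T) vy2).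
(* v^-1 k lies both in the left coset v^-1 H and in the right coset Ht. *)
have [T' T'c T'P] := nrt_replace T cH.
have lc y : y \in l -> ~~ (y ~ v^-1 * k).
  move=> /lP[Ty vy]; apply: contra vt; rewrite -(same_coset_eqr _ tc) => yt.
  by rewrite -(nrt_uniq Ty Tt yt).
suff /maxS : crowded T' n.+1 by rewrite ltnn.
exists v, (v^-1 * k :: l); split=> [||y]; last 1 first.
- rewrite inE => /orP[/eqP ->|yl]; first by rewrite mulVKg.
  by have [Ty vy] := lP _ yl; split=> //; apply: T'P (lc _ yl).
- rewrite /= ul andbT; apply/negP => /lc.
  by rewrite same_coset_refl.
- by rewrite /= sl.
Qed.

End SameCoset.

Theorem theorem1p2 (G : groupType) (H : groupClosed G)
    (finH : finite_order H \/ finite_index H) :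
  [<-> normal_subgroup H;
       forall S : nrt H, both_sided_transversal H S;
       forall S T : nrt H, nrt_isomorphic S T;
       forall S : nrt H, right_inverse_property S;
       forall S : nrt H, right_conjugacy_closed S].
Proof.
tfae.
- by move=> nH S; exact: normal_both_sided.
- by move=> /both_sided_normal nH S T; exact: normal_isomorphic.
- by move=> /(isomorphic_normal finH) nH S; exact: normal_rip.
- by move=> /rip_normal nH S; exact: normal_rcc.
- exact: rcc_normal.
Qed.
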